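(* For a multi-unit auction with $m\ge2$ identical items and $n\ge2$ unknown single-minded bidders, no randomized mechanism that is (universally) obviously strategy-proof and satisfies individual rationality and no negative transfers has approximation better than $\frac{6}{5}$; i.e., every such mechanism has $\sup_v\mathrm{OPT}(v)/\mathbb{E}[W(v)]\ge 6/5$.
   Context: A multi-unit auction: bidder $i$'s valuation is $v_i:\{0,\dots,m\}\to\mathbb{R}_{\ge0}$. It is single-minded if there are $x_i\ge0$, $d_i\in\{1,\dots,m\}$ with $v_i(q)=x_i$ for $q\ge d_i$ and $0$ otherwise; unknown single-minded means both $x_i,d_i$ are private, so the domain $V_i$ is all single-minded valuations. Utilities are quasi-linear. A deterministic mechanism is a rooted tree: each internal node is assigned to one bidder, who sends one of the messages labeling the outgoing edges; each leaf is labeled with a feasible allocation (quantities summing to at most $m$) and a payment for each bidder. A behavior $B_i$ specifies a message at every node of bidder $i$; a profile $B$ determines a path $\mathrm{Path}(B)$ with allocation $f_i(B)$ and payment $p_i(B)$ for $i$. A strategy $\mathcal S_i$ maps each $v_i\in V_i$ to a behavior; it is obviously dominant if for every $v_i\in V_i$, every node $u$ of $i$, every $B_{-i}$ and every profile $B'$ with $u\in\mathrm{Path}(\mathcal S_i(v_i),B_{-i})\cap\mathrm{Path}(B')$ and $B'_i$ sending at $u$ a message different from $\mathcal S_i(v_i)$'s, $v_i(f_i(\mathcal S_i(v_i),B_{-i}))-p_i(\mathcal S_i(v_i),B_{-i})\ge v_i(f_i(B'))-p_i(B')$. A randomized mechanism is a probability distribution over deterministic mechanisms each with strategies; it is universally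 OSP if each mechanism in its support is OSP. Individual rationality: in every mechanism of the support and for every profile in $\prod_iV_i$, following the strategies yields each bidder utility $\ge0$. No negative transfers: all payments at all leaves of all mechanisms in the support are $\ge0$. $\mathbb{E}[W(v)]$ is the expected welfare when bidders follow their strategies on profile $v$; $\mathrm{OPT}(v)$ is the optimal welfare. *)

(* Defs.v *)
From HB Require Import structures.
From mathcomp Require Import all_boot all_order all_algebra.
From mathcomp Require Import all_classical all_reals all_analysis.
Set Implicit Arguments.
Unset Strict Implicit.
Unset Printing Implicit Defensive.
Import Order.TTheory GRing.Theory Num.Theory.
Local Open Scope ring_scope.

Section Auction.
Variables (R : realType) (n m : nat) (M : Type).

(* Valuations v : {0,...,m} -> R>=0, represented as functions nat -> R.
   Single-minded: v q = x if q >= d, 0 otherwise, with x >= 0, 1 <= d <= m.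
   (Values beyond m are then forced to x, so the representation is unique.) *)
Definition single_minded (v : nat -> R) : Prop :=
  exists (x : R) (d : nat), 0 <= x /\ (1 <= d <= m)%N /\
    forall q : nat, v q = if (d <= q)%N then x else 0.

(* Deterministic mechanism: a rooted tree.  An internal node is owned by a
   bidder i, has a set P of admissible messages (labels of outgoing edges)
   and a child ch x for each message x (only x with P x are edges).
   Leaves carry an allocation and a payment for every bidder.
   M is the (arbitrary) type of messages. *)
Inductive tree : Type :=
| Leaf of ('I_n -> nat) & ('I_n -> R)
| Node of 'I_n & (M -> Prop) & (M -> tree).

(* Nodes are identified by their address: the sequence of messages from
   the root.  at_addr t a t' : t' is the node of t at address a. *)
Inductive at_addr : tree -> seq M -> tree -> Prop :=
| at_root t : at_addr t [::] t
| at_step i (P : M -> Prop) ch x a t' :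
    P x -> at_addr (ch x) a t' -> at_addr (Node i P ch) (x :: a) t'.

Definition behavior := seq M -> M.
Definition profile := 'I_n -> behavior.

Definition valid_beh (t : tree) (i : 'I_n) (b : behavior) : Prop :=
  forall a P ch, at_addr t a (Node i P ch) -> P (b a).

Definition valid_profile (t : tree) (B : profile) : Prop :=
  forall i, valid_beh t i (B i).

Fixpoint run (t : tree) (B : profile) (a : seq M) : ('I_n -> nat) * ('I_n -> R) :=
  match t with
  | Leaf f p => (f, p)
  | Node i _ ch => run (ch (B i a)) B (rcons a (B i a))
  end.

Fixpoint visits (t : tree) (B : profile) (a u : seq M) : Prop :=
  match t with
  | Leaf _ _ => u = a
  | Node i _ ch => u = a \/ visits (ch (B i a)) B (rcons a (B i a)) u
  end.

Definition outcome (t : tree) (B : profile) := run t B [::].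
Definition on_path (t : tree) (B : profile) (u : seq M) := visits t B [::] u.

Definition upd (B : profile) (i : 'I_n) (b : behavior) : profile :=
  fun j => if j == i then b else B j.

Definition utility (v : nat -> R) (i : 'I_n) (o : ('I_n -> nat) * ('I_n -> R)) : R :=
  v (o.1 i) - o.2 i.

Definition strategies := 'I_n -> (nat -> R) -> behavior.

Definition strat_profile (S : strategies) (vs : 'I_n -> nat -> R) : profile :=
  fun j => S j (vs j).

Definition feasible_leaves (t : tree) : Prop :=
  forall a f p, at_addr t a (Leaf f p) -> (\sum_(i < n) f i <= m)%N.

Definition strategies_valid (t : tree) (S : strategies) : Prop :=
  forall i v, single_minded v -> valid_beh t i (S i v).

Definition OSP (t : tree) (S : strategies) : Prop :=
  forall (i : 'I_n) (v : nat -> R), single_minded v ->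
  forall (u : seq M) (P : M -> Prop) (ch : M -> tree),
    at_addr t u (Node i P ch) ->
  forall B B' : profile, valid_profile t B -> valid_profile t B' ->
    on_path t (upd B i (S i v)) u -> on_path t B' u ->
    B' i u <> S i v u ->
    utility v i (outcome t B') <= utility v i (outcome t (upd B i (S i v))).

Definition individually_rational (t : tree) (S : strategies) : Prop :=
  forall vs : 'I_n -> nat -> R, (forall j, single_minded (vs j)) ->
  forall i, 0 <= utility (vs i) i (outcome t (strat_profile S vs)).

Definition no_negative_transfers (t : tree) : Prop :=
  forall a f p, at_addr t a (Leaf f p) -> forall i, 0 <= p i.

Definition good_mech (t : tree) (S : strategies) : Prop :=
  [/\ feasible_leaves t, strategies_valid t S, OSP t S,
      individually_rational t S & no_negative_transfers t].

Definition welfare (t : tree) (S : strategies) (vs : 'I_n -> nat -> R) : R :=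
  \sum_(i < n) vs i ((outcome t (strat_profile S vs)).1 i).

End Auction.

Definition OPT (R : realType) (n m : nat) (vs : 'I_n -> nat -> R) : R :=
  \big[Num.max/0]_(q : {ffun 'I_n -> 'I_m.+1} | (\sum_(i < n) (q i : nat) <= m)%N)
     \sum_(i < n) vs i (q i).

(* Main.v *)
Require Import Defs.
From HB Require Import structures.
From mathcomp Require Import all_boot all_order all_algebra.
From mathcomp Require Import all_classical all_reals all_analysis.
From mathcomp Require Import lra.
Import Order.TTheory GRing.Theory Num.Theory.
Local Open Scope ring_scope.

(** Consider two bidders whose types are among a = (1, 1), C = (K, m),
    A = (K^2, 1), D = (K^3, m), written (value, demand), all others having value
    0.  Suppose that both bidders win on (a, a), that C wins against a and that D
    wins against A, in both orders.  At a node reached by all these profiles no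
    bidder can separate two of these types: A loses against D, so its worst
    utility is nonpositive and any type leaving it pays at least K^2 when it
    receives an item.  This excludes a and C, which win somewhere and pay at most
    1 and K; and D would then have utility at most K^3 - K^2 against A, less than
    by imitating C.  Hence the outcome is the same on all these profiles, which is
    absurd since each bidder gets all m items on one of them.  So every
    deterministic mechanism loses half the welfare on (a, a), or all but a
    fraction 1/K of it on one of the other four profiles.  With weight 1/3 on
    (a, a) and 1/6 on each of the others, its average ratio to the optimum is at
    most 5/6 + 1/(6K), hence the same holds for the randomized mechanism, and it
    remains to let K grow. *)

(** * Paths and outcomes in mechanism trees *)

Section Trees.
Context {R : realType} {n m : nat} {M : Type}.
Implicit Types (t : tree R n M) (S : strategies R n M) (vs : 'I_n -> nat -> R).

Lemma at_addr_cat t a t' b t'' :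
  at_addr t a t' -> at_addr t' b t'' -> at_addr t (a ++ b) t''.
Proof. by elim=> // i P ch x c s Px _ IH /IH; apply: at_step. Qed.

Lemma at_addr_rcons t u i (P : M -> Prop) ch x :
  at_addr t u (Node i P ch) -> P x -> at_addr t (rcons u x) (ch x).
Proof.
move=> tu Px; rewrite -cats1; apply: at_addr_cat (tu) _.
by apply: at_step Px _; apply: at_root.
Qed.

(** Transfers the conditions imposed on leaves, feasibility and nonnegative payments, to
    outcomes. *)
Lemma outcome_leaf t (B : profile n M) : valid_profile t B ->
  exists a, at_addr t a (Leaf M (outcome t B).1 (outcome t B).2).
Proof.
move=> vB; rewrite /outcome.
suff H t' u : at_addr t u t' ->
    exists a, at_addr t a (Leaf M (run t' B u).1 (run t' B u).2).
  by apply: H; apply: at_root.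
elim: t' u => [f p|i P ch IH] u tu /=; first by exists u.
by apply: IH; apply: at_addr_rcons (tu) _; apply: vB tu.
Qed.

Lemma good_valid t S vs : good_mech m t S ->
  (forall j, single_minded m (vs j)) -> valid_profile t (strat_profile S vs).
Proof. by case=> _ sv _ _ _ smv i; apply: sv. Qed.

Lemma good_feasible t S vs : good_mech m t S ->
  (forall j, single_minded m (vs j)) ->
  (\sum_(i < n) (outcome t (strat_profile S vs)).1 i <= m)%N.
Proof.
move=> g smv; have [a ta] := outcome_leaf _ _ (good_valid _ _ _ g smv).
by case: g => fl _ _ _ _; apply: fl ta.
Qed.

Lemma good_payment_ge0 t S vs i : good_mech m t S ->
  (forall j, single_minded m (vs j)) ->
  0 <= (outcome t (strat_profile S vs)).2 i.
Proof.
move=> g smv; have [a ta] := outcome_leaf _ _ (good_valid _ _ _ g smv).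
by case: g => _ _ _ _ nt; apply: nt ta _.
Qed.

(* Obvious dominance compares the two outcomes although the opponents' types differ too. *)
Lemma OSP_split t S vs vs' u i P ch : good_mech m t S ->
  (forall j, single_minded m (vs j)) -> (forall j, single_minded m (vs' j)) ->
  at_addr t u (Node i P ch) ->
  on_path t (strat_profile S vs) u -> on_path t (strat_profile S vs') u ->
  S i (vs' i) u <> S i (vs i) u ->
  utility (vs i) i (outcome t (strat_profile S vs')) <=
  utility (vs i) i (outcome t (strat_profile S vs)).
Proof.
move=> g smv smv' tu pv pv' ne.
have updE : upd (strat_profile S vs) i (S i (vs i)) = strat_profile S vs.
  by apply/funext => j; rewrite /upd; case: eqP => // ->.
have [_ _ osp _ _] := g.
have := osp i (vs i) (smv i) u P ch tu (strat_profile S vs) (strat_profile S vs').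
by rewrite updE; apply => //; exact: good_valid g _.
Qed.

(** As long as the profiles of [Q] have met the same nodes, the owner of the current node sends one
    message for all of them, so they move on to the same child. Hence agreement is required only at
    nodes that all of [Q] reaches. *)
Lemma indistinguishable_outcome t S (Q : ('I_n -> nat -> R) -> Prop) :
  (forall vs, Q vs -> valid_profile t (strat_profile S vs)) ->
  (forall u i P ch, at_addr t u (Node i P ch) ->
     (forall vs, Q vs -> on_path t (strat_profile S vs) u) ->
     forall vs vs', Q vs -> Q vs' -> S i (vs i) u = S i (vs' i) u) ->
  forall vs vs', Q vs -> Q vs' ->
    outcome t (strat_profile S vs) = outcome t (strat_profile S vs').
Proof.
move=> Qv same vs vs' Qvs Qvs'; rewrite /outcome.
(* Induction on the subtree at [u]; the second premise records that whatever [Q] visits below [u]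
   lies on its path from the root. *)
suff H t' u : at_addr t u t' ->
    (forall ws, Q ws -> forall u', visits t' (strat_profile S ws) u u' ->
       on_path t (strat_profile S ws) u') ->
    run t' (strat_profile S vs) u = run t' (strat_profile S vs') u.
  by apply: H => //; apply: at_root.
elim: t' u => // i P ch IH u tu on /=.
have on_u ws : Q ws -> on_path t (strat_profile S ws) u.
  by move=> Qws; apply: on => //; left.
have sameQ := same _ _ _ _ tu on_u.
have -> : strat_profile S vs' i u = strat_profile S vs i u by exact: sameQ.
apply: IH => [|ws Qws u' vis].
  by apply: at_addr_rcons (tu) _; apply: (Qv _ Qvs) tu.
apply: on => //=; right.
by have -> : strat_profile S ws i u = strat_profile S vs i u by exact: sameQ.
Qed.

End Trees.

(** * Profiles with two active bidders *)

Definition sm_val {R : realType} (x : R) (d q : nat) : R :=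
  if (d <= q)%N then x else 0.

Definition two_active {R : realType} {n : nat} (i j : 'I_n) (x y : nat -> R) :
    'I_n -> nat -> R :=
  fun k => if k == i then x else if k == j then y else sm_val 0 1.

(** Lets statements proved for the first active bidder be reused for the second. *)
Lemma two_activeC {R : realType} {n : nat} (i j : 'I_n) (x y : nat -> R) :
  i != j -> two_active i j x y = two_active j i y x.
Proof.
move=> ij; apply/funext => k; rewrite /two_active.
by case: (eqVneq k i) => [->|//]; rewrite (negbTE ij).
Qed.

Lemma two_active1 {R : realType} {n : nat} (i j : 'I_n) (x y : nat -> R) :
  two_active i j x y i = x.
Proof. by rewrite /two_active eqxx. Qed.

Lemma sum_two_active {R : realType} {n : nat} (i j : 'I_n) (x y : nat -> R)
    (f : 'I_n -> nat) : i != j ->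
  \sum_(k < n) two_active i j x y k (f k) = x (f i) + y (f j).
Proof.
move=> ij; rewrite (bigD1 i) //= (bigD1 j) 1?eq_sym //= big1 => [|k /andP[ki kj]].
  by rewrite two_active1 two_activeC // two_active1 addr0.
by rewrite /two_active (negbTE ki) (negbTE kj) /sm_val; case: ifP.
Qed.

Lemma sum_two_le {n : nat} (i j : 'I_n) (f : 'I_n -> nat) : i != j ->
  (f i + f j <= \sum_(k < n) f k)%N.
Proof.
move=> ij; rewrite (bigD1 i) //= (bigD1 j) 1?eq_sym //= addnA.
exact: leq_addr.
Qed.

Lemma OPT_two_active {R : realType} {n m : nat} (i j : 'I_n) (x y : nat -> R) 
    (p q : nat) : i != j -> (p + q <= m)%N ->
  x p + y q <= OPT m (two_active i j x y).
Proof.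
move=> ij pq.
pose f : {ffun 'I_n -> 'I_m.+1} :=
  [ffun k => inord (if k == i then p else if k == j then q else 0%N)].
have fi : f i = p :> nat.
  by rewrite ffunE eqxx inordK // ltnS (leq_trans _ pq) // leq_addr.
have fj : f j = q :> nat.
  by rewrite ffunE eq_sym (negbTE ij) eqxx inordK // ltnS (leq_trans _ pq) // leq_addl.
have f0 k : k != i -> k != j -> f k = 0%N :> nat.
  by move=> ki kj; rewrite ffunE (negbTE ki) (negbTE kj) inordK.
have -> : x p + y q = \sum_(k < n) two_active i j x y k (f k).
  by rewrite (sum_two_active i j x y (fun k => f k : nat)) // fi fj.
rewrite /OPT; apply: (le_bigmax_cond 0 (fun g : {ffun 'I_n -> 'I_m.+1} => 
  \sum_(k < n) two_active i j x y k (g k))).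
rewrite (bigD1 i) //= (bigD1 j) 1?eq_sym //= big1 => [|k /andP[ki kj]].
  by rewrite fi fj addn0.
exact: f0.
Qed.

Lemma sm_val_bounds {R : realType} (x : R) (d q : nat) :
  0 <= x -> 0 <= sm_val x d q <= x.
Proof. by move=> x0; rewrite /sm_val; case: ifP; rewrite ?x0 ?lexx. Qed.

Lemma sm_val_single_minded {R : realType} {m : nat} (x : R) (d : nat) :
  0 <= x -> (1 <= d <= m)%N -> single_minded m (sm_val x d).
Proof. by move=> x0 dm; exists x, d. Qed.

Lemma two_active_single_minded {R : realType} {n m : nat} (i j : 'I_n)
    (x y : nat -> R) : (0 < m)%N -> single_minded m x -> single_minded m y ->
  forall k, single_minded m (two_active i j x y k).
Proof.
move=> m0 smx smy k; rewrite /two_active; case: ifP => // _; case: ifP => // _.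
exact: sm_val_single_minded.
Qed.

(** * The four hard types and the impossibility of separating them *)

Section HardInstances.
Context {R : realType} {n m : nat} {M : Type}.
Variables (K : R) (t : tree R n M) (S : strategies R n M).
Implicit Types (i j : 'I_n) (x y : nat -> R).

Local Notation a := (sm_val 1 1 : nat -> R).
Local Notation C := (sm_val K m).
Local Notation A := (sm_val (K ^+ 2) 1).
Local Notation D := (sm_val (K ^+ 3) m).

Definition hard_type (x : nat -> R) := [\/ x = a, x = A, x = C | x = D].

Lemma hard_type_single_minded x : 1 < K -> (2 <= m)%N -> hard_type x -> single_minded m x.
Proof.
move=> K1 m2; have K0 : 0 <= K by lra.
by case=> ->; apply: sm_val_single_minded; rewrite ?exprn_ge0 ?leqnn ?andbT // ltnW.
Qed.

Local Notation out i j x y :=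
  (outcome t (strat_profile S (two_active i j x y))).

Lemma hard_single_minded i j x y : 1 < K -> (2 <= m)%N -> hard_type x -> hard_type y ->
  forall k, single_minded m (two_active i j x y k).
Proof.
move=> K1 m2 hx hy; apply: two_active_single_minded; first exact: ltnW.
  exact: hard_type_single_minded.
exact: hard_type_single_minded.
Qed.

Lemma hard_no_split i j u P ch : 1 < K -> (2 <= m)%N -> good_mech m t S ->
  at_addr t u (Node i P ch) ->
  (forall x y, hard_type x -> hard_type y ->
     on_path t (strat_profile S (two_active i j x y)) u) ->
  (1 <= (out i j a a).1 i)%N ->
  (out i j A D).1 i = 0%N ->
  (m <= (out i j C a).1 i)%N ->
  forall x, hard_type x -> S i x u = S i A u.
Proof.
move=> K1 m2 g tu on aa AD Ca.
have ha : hard_type a by constructor 1.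
have hA : hard_type A by constructor 2.
have hC : hard_type C by constructor 3.
have hD : hard_type D by constructor 4.
have split x y x' y' : hard_type x -> hard_type y -> hard_type x' -> hard_type y' ->
    S i x' u <> S i x u ->
    x ((out i j x' y').1 i) - (out i j x' y').2 i <=
    x ((out i j x y).1 i) - (out i j x y).2 i.
  move=> hx hy hx' hy' ne.
  have := OSP_split t S (two_active i j x y) (two_active i j x' y') u i P ch g
    (hard_single_minded _ _ _ _ K1 m2 hx hy) (hard_single_minded _ _ _ _ K1 m2 hx' hy') tu
    (on _ _ hx hy) (on _ _ hx' hy').
  by rewrite /utility !two_active1; apply.
have pay x y : hard_type x -> hard_type y -> 0 <= (out i j x y).2 i.
  by move=> hx hy; apply: (good_payment_ge0 _ _ _ _ g); apply: hard_single_minded.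
have ir x y : hard_type x -> hard_type y ->
    (out i j x y).2 i <= x ((out i j x y).1 i).
  move=> hx hy; have [_ _ _ IR _] := g.
  have := IR _ (hard_single_minded i j x y K1 m2 hx hy) i.
  by rewrite /utility two_active1 subr_ge0.
have K2 : K < K ^+ 2 by nra.
have K3 : K ^+ 2 < K ^+ 3 by rewrite exprS; nra.
have m1 : (1 <= m)%N by exact: ltnW.
(* Obvious dominance for [A] is measured against its loss to [D], where its utility is at most 0; so
   no deviation may give [A] positive utility, whatever the opponent. *)
have A_deviation x y : hard_type x -> hard_type y -> S i x u <> S i A u ->
    A ((out i j x y).1 i) <= (out i j x y).2 i.
  move=> hx hy ne; have := split A D x y hA hD hx hy ne.
  have := pay A D hA hD; have A0 : A 0%N = 0 by [].
  by rewrite AD A0; lra.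
(* Otherwise [a], winning on [(a, a)], would pay at least [K ^+ 2], while individual rationality
   caps its payment at 1. For [C] against [a] the cap is [K]. *)
have eqa : S i a u = S i A u.
  apply: contrapT => ne; have := A_deviation _ _ ha ha ne; have := ir a a ha ha.
  by rewrite /sm_val aa; lra.
have eqC : S i C u = S i A u.
  apply: contrapT => ne; have := A_deviation _ _ hC ha ne; have := ir C a hC ha.
  by rewrite /sm_val Ca (leq_trans m1 Ca); lra.
have eqD : S i D u = S i A u.
  apply: contrapT => ne; have := A_deviation _ _ hD hA ne.
  have := pay D A hD hA; have := ir C a hC ha.
  (* By imitating [C] against [a], type [D] gets utility at least [K ^+ 3 - K]. Against [A] it gets
     at most [K ^+ 3 - K ^+ 2] if it wins and at most 0 if it loses. *)
  have : S i C u <> S i D u by rewrite eqC => e; apply: ne.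
  move=> /(split D A C a hD hA hC ha); rewrite /sm_val Ca.
  case: (leqP m) => [mf|_]; last by lra.
  by rewrite (leq_trans m1 mf); lra.
by move=> x [] ->.
Qed.

Lemma two_active_feasible i j x y : 1 < K -> (2 <= m)%N -> good_mech m t S ->
  i != j -> hard_type x -> hard_type y ->
  ((out i j x y).1 i + (out i j x y).1 j <= m)%N.
Proof.
move=> K1 m2 g ij hx hy; apply: leq_trans (sum_two_le i j _ ij) _.
by apply: (good_feasible t S _ g); apply: hard_single_minded.
Qed.

Lemma hard_contradiction i j : 1 < K -> (2 <= m)%N -> good_mech m t S -> i != j ->
  (1 <= (out i j a a).1 i)%N -> (1 <= (out i j a a).1 j)%N ->
  (m <= (out i j C a).1 i)%N -> (m <= (out i j a C).1 j)%N ->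
  (m <= (out i j A D).1 j)%N -> (m <= (out i j D A).1 i)%N -> False.
Proof.
have ha : hard_type a by constructor 1.
have hA : hard_type A by constructor 2.
have hC : hard_type C by constructor 3.
have hD : hard_type D by constructor 4.
move=> K1 m2 g ij aai aaj Ca aC AD DA.
have m1 : (1 <= m)%N by exact: ltnW.
pose Q vs := exists x y, [/\ hard_type x, hard_type y & vs = two_active i j x y].
have QE x y : hard_type x -> hard_type y -> Q (two_active i j x y) by exists x, y.
(* A common outcome of [(C, a)] and [(a, C)] would hand out all [m] items twice. *)
suff same vs vs' : Q vs -> Q vs' ->
    outcome t (strat_profile S vs) = outcome t (strat_profile S vs').
  have := two_active_feasible i j C a K1 m2 g ij hC ha.
  move: aC; rewrite (same _ _ (QE _ _ ha hC) (QE _ _ hC ha)) => aC.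
  by move=> /(leq_trans (leq_add Ca aC)); rewrite -{3}(addn0 m) leq_add2l leqNgt m1.
apply: indistinguishable_outcome => [ws [x [y [hx hy ->]]]|].
  by apply: good_valid g _; apply: hard_single_minded.
move=> u k P ch tu on _ _ [x [y [hx hy ->]]] [x' [y' [hx' hy' ->]]].
rewrite /two_active; case: (eqVneq k i) => [ki|_]; last case: (eqVneq k j) => [kj|//].
- subst k.
  have H : forall z, hard_type z -> S i z u = S i A u.
    apply: (hard_no_split i j u P ch K1 m2 g tu) => // [z z' hz hz'|].
      exact: on (QE _ _ hz hz').
    (* [D] takes all [m] items, so feasibility leaves none for [A]. *)
    apply/eqP; rewrite -leqn0 -(leq_add2r m) add0n.
    by apply: leq_trans (two_active_feasible _ _ _ _ K1 m2 g ij hA hD); rewrite leq_add2l.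
  by rewrite !H.
- subst k.
  have H : forall z, hard_type z -> S j z u = S j A u.
    apply: (hard_no_split j i u P ch K1 m2 g tu);
      rewrite ?(two_activeC j i) 1?eq_sym //.
    + move=> z z' hz hz'; rewrite two_activeC 1?eq_sym //; exact: on (QE _ _ hz' hz).
    + apply/eqP; rewrite -leqn0 -(leq_add2l m) addn0.
      by apply: leq_trans (two_active_feasible _ _ _ _ K1 m2 g ij hD hA); rewrite leq_add2r.
  by rewrite !H.
Qed.

(** * Welfare of a deterministic mechanism on the hard profiles *)

Local Notation W i j x y := (welfare t S (two_active i j x y)).

Lemma welfareE i j x y : i != j ->
  W i j x y = x ((out i j x y).1 i) + y ((out i j x y).1 j).
Proof. by move=> ij; rewrite /welfare sum_two_active. Qed.

(** Serving demand [m] leaves nothing for the other bidder. The test in the bound is the winning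
    condition that [hard_contradiction] takes as hypothesis. *)
Lemma welfare_conflict i j (x y : R) : 1 < K -> (2 <= m)%N -> good_mech m t S ->
  i != j -> 0 <= x -> 0 <= y ->
  hard_type (sm_val x 1) -> hard_type (sm_val y m) ->
  W i j (sm_val x 1) (sm_val y m) <= 
    if (m <= (out i j (sm_val x 1) (sm_val y m)).1 j)%N then y else x.
Proof.
move=> K1 m2 g ij x0 y0 hx hy; rewrite welfareE //; have := two_active_feasible _ _ _ _ K1 m2 g ij hx hy.
set f := (out _ _ _ _).1; case: ifP => mf le; last first.
  have -> : sm_val y m (f j) = 0 by rewrite /sm_val mf.
  by rewrite addr0; have /andP[] := sm_val_bounds x 1 (f i) x0.
have -> : f i = 0%N.
  by apply/eqP; rewrite -leqn0 -(leq_add2r m) add0n; apply: leq_trans le; rewrite leq_add2l.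
by rewrite add0r; have /andP[] := sm_val_bounds y m (f j) y0.
Qed.

(* The coefficients are [6 p / OPT] where [p] is the weight of the profile, 1/3 for
   [(a, a)] and 1/6 for the four others. *)
Lemma hard_welfare_sum i j : 1 < K -> (2 <= m)%N -> good_mech m t S -> i != j ->
  W i j a a + K^-1 * W i j C a + K^-1 * W i j a C
    + K^-1 ^+ 3 * W i j A D + K^-1 ^+ 3 * W i j D A <= 5 + K^-1.
Proof.
move=> K1 m2 g ij; have K0 : 0 < K by lra.
have ji : j != i by rewrite eq_sym.
have ha : hard_type a by constructor 1.
have hA : hard_type A by constructor 2.
have hC : hard_type C by constructor 3.
have hD : hard_type D by constructor 4.
have K20 : 0 <= K ^+ 2 by rewrite exprn_ge0 // ltW.
have K30 : 0 <= K ^+ 3 by rewrite exprn_ge0 // ltW.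
have := welfare_conflict i j 1 K K1 m2 g ij ler01 (ltW K0) ha hC.
have := welfare_conflict j i 1 K K1 m2 g ji ler01 (ltW K0) ha hC.
have := welfare_conflict i j _ _ K1 m2 g ij K20 K30 hA hD.
have := welfare_conflict j i _ _ K1 m2 g ji K20 K30 hA hD.
rewrite !(two_activeC j i) //.
have : W i j a a <= if (1 <= (out i j a a).1 i)%N && (1 <= (out i j a a).1 j)%N
    then 2 else 1.
  by rewrite welfareE // /sm_val; do 2!case: ifP => _ /=; lra.
have k0 : 0 < K^-1 by rewrite invr_gt0.
have k1 : K^-1 < 1 by rewrite invf_lt1.
have kK : K^-1 * K = 1 by rewrite mulVf // gt_eqF.
have k3 : 0 < K^-1 ^+ 3 by rewrite exprn_gt0.
(* After scaling, the term of [(a, a)] is at most 2 and each other term at most 1; when the desired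
   winners fail to win, these drop to 1 and [K^-1] respectively. *)
have scale (w x y z : R) (b : bool) : 0 < z -> w <= (if b then y else x) -> x <= y ->
    z * w <= z * y /\ (b \/ z * w <= z * x).
  move=> z0; rewrite !ler_pM2l //; case: b => [|wx xy]; first by split; [|left].
  by split; [apply: le_trans xy|right].
have K33 : K^-1 ^+ 3 * K ^+ 3 = 1 by rewrite -exprMn kK expr1n.
have K32 : K^-1 ^+ 3 * K ^+ 2 = K^-1.
  by rewrite exprSr mulrAC -exprMn kK expr1n mul1r.
have K23 : K ^+ 2 <= K ^+ 3 by rewrite exprS; nra.
move=> /(scale _ _ _ 1 _ ltr01) /(_ _)[|]; first by lra.
rewrite !mul1r => aa aa'.
move=> /(scale _ _ _ _ _ k3) /(_ K23); rewrite K33 K32 => -[DA DA'].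
move=> /(scale _ _ _ _ _ k3) /(_ K23); rewrite K33 K32 => -[AD AD'].
move=> /(scale _ _ _ _ _ k0) /(_ (ltW K1)); rewrite mulr1 kK => -[Ca Ca'].
move=> /(scale _ _ _ _ _ k0) /(_ (ltW K1)); rewrite mulr1 kK => -[aC aC'].
(* The full bounds add up to 6, and a single failure brings the sum down to at most [5 + K^-1]. The
   five successes together are contradictory. *)
case: aa' => [/andP[aai aaj]|?]; last by lra.
case: DA' => [DA''|?]; last by lra.
case: AD' => [AD''|?]; last by lra.
case: Ca' => [Ca''|?]; last by lra.
case: aC' => [aC''|?]; last by lra.
by case: (hard_contradiction i j K1 m2 g ij).
Qed.

Lemma welfare_bounds i j (x y : R) (d e : nat) : 0 <= x -> 0 <= y -> i != j ->
  0 <= W i j (sm_val x d) (sm_val y e) <= x + y.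
Proof.
move=> x0 y0 ij; rewrite welfareE //.
have /andP[? ?] := sm_val_bounds x d ((out i j (sm_val x d) (sm_val y e)).1 i) x0.
have /andP[? ?] := sm_val_bounds y e ((out i j (sm_val x d) (sm_val y e)).1 j) y0.
by rewrite addr_ge0 ?lerD.
Qed.

End HardInstances.

(** * Averaging over the randomized mechanism *)

(** Integrability is returned along with the formula so that the weighted sum can be built term by
    term. *)
Lemma Rintegral_addZ {d} {T : measurableType d} {R : realType}
    (mu : {measure set T -> \bar R}) (c : R) (f g : T -> R) :
  mu.-integrable setT (EFin \o f) -> mu.-integrable setT (EFin \o g) ->
  mu.-integrable setT (EFin \o (fun w => f w + c * g w)) /\
  (\int[mu]_w (f w + c * g w) = \int[mu]_w f w + c * \int[mu]_w g w)%R.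
Proof.
move=> intf intg; have mT := @measurableT _ T.
have intcg : mu.-integrable setT (EFin \o (fun w => c * g w)).
  by have := integrableZl mT c intg.
split; first by have := integrableD mT intf intcg.
by rewrite RintegralD // RintegralZl.
Qed.

Theorem theorem3p6 (R : realType) (n m : nat) (Hm : (2 <= m)%N) (Hn : (2 <= n)%N)
  (M : Type) (d : measure_display) (Omega : measurableType d)
  (Pr : probability Omega R)
  (mech : Omega -> tree R n M) (strat : Omega -> strategies R n M)
  (Hgood : forall w, good_mech m (mech w) (strat w))
  (Hmeas : forall vs : 'I_n -> nat -> R, (forall i, single_minded m (vs i)) ->
     measurable_fun setT (fun w => welfare (mech w) (strat w) vs)) :
  forall r : R, r < 6 / 5 ->
  exists vs : 'I_n -> nat -> R, (forall i, single_minded m (vs i)) /\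
    (r%:E * (\int[Pr]_w (welfare (mech w) (strat w) vs)%:E) < (OPT m vs)%:E)%E.
Proof.
move=> r r65; apply: contrapT => none.
pose i : 'I_n := Ordinal (ltnW Hn); pose j : 'I_n := Ordinal Hn.
have ij : i != j by [].
(* Chosen so that [K * (6 - 5 * r)] exceeds the absolute value of [r], which yields
   [r * (5 + K^-1) < 6]; the summand 2 ensures [1 < K]. *)
pose K : R := 2 + `|r| / (6 - 5 * r).
have r0 : 0 < 6 - 5 * r by lra.
have K2 : 2 <= K by rewrite lerDl divr_ge0 // ltW.
have K1 : 1 < K by lra.
have K0 : 0 < K by lra.
have rK : r * (5 + K^-1) < 6.
  have : `|r| * K^-1 < 6 - 5 * r.
    rewrite ltr_pdivrMr // /K mulrDr mulrCA divff ?gt_eqF // mulr1.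
    by have := normr_ge0 r; lra.
  have : r * K^-1 <= `|r| * K^-1.
    by apply: ler_wpM2r; [rewrite invr_ge0 ltW|exact: ler_norm].
  lra.
pose W vs w := welfare (mech w) (strat w) vs.
pose E vs := (\int[Pr]_w W vs w)%R.
have mT := @measurableT _ Omega.
have bound (x y : R) p q : 0 <= x -> 0 <= y -> forall w,
    0 <= W (two_active i j (sm_val x p) (sm_val y q)) w <= x + y.
  by move=> x0 y0 w; apply: welfare_bounds.
have sm (x y : R) p q : 0 <= x -> 0 <= y -> (1 <= p <= m)%N -> (1 <= q <= m)%N ->
    forall k, single_minded m (two_active i j (sm_val x p) (sm_val y q) k).
  move=> x0 y0 pm qm; apply: two_active_single_minded; first exact: ltnW.
    exact: sm_val_single_minded.
  exact: sm_val_single_minded.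
have integ (x y : R) p q : 0 <= x -> 0 <= y -> (1 <= p <= m)%N -> (1 <= q <= m)%N ->
    Pr.-integrable setT (EFin \o W (two_active i j (sm_val x p) (sm_val y q))).
  move=> x0 y0 pm qm; apply: measurable_bounded_integrable => //.
  - by rewrite [X in (X < _)%E]probability_setT ltry.
  - by apply: Hmeas; apply: sm.
  - exists (x + y); split; first exact: num_real.
    move=> z xyz w _; have /andP[W0 Wxy] := bound _ _ p q x0 y0 w.
    by rewrite /= ger0_norm // (le_trans Wxy) // ltW.
(* The negated conclusion bounds [OPT] by [r] times expected welfare, and the allocation [(p', q')]
   bounds [OPT] from below. Finiteness of the integral permits passing to real numbers. *)
have opt (x y : R) p q p' q' c : 0 <= x -> 0 <= y -> (1 <= p <= m)%N -> (1 <= q <= m)%N ->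
    (p' + q' <= m)%N -> sm_val x p p' + sm_val y q q' = c ->
    c <= r * E (two_active i j (sm_val x p) (sm_val y q)).
  move=> x0 y0 pm qm pq <-; apply: le_trans (OPT_two_active _ _ _ _ _ _ ij pq) _.
  rewrite leNgt; apply/negP => lt; apply: none.
  exists (two_active i j (sm_val x p) (sm_val y q)); split; first exact: sm.
  have fin := integrable_fin_num mT (integ _ _ _ _ x0 y0 pm qm).
  by rewrite -(fineK fin) -EFinM lte_fin.
have m0 : (0 < m)%N by exact: ltnW.
have m1 : (1 <= 1 <= m)%N by [].
have mm : (1 <= m <= m)%N by rewrite leqnn andbT.
have KK : 0 <= K by exact: ltW.
have K20 : 0 <= K ^+ 2 by rewrite exprn_ge0.
have K30 : 0 <= K ^+ 3 by rewrite exprn_ge0.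
have smT (x : R) p : sm_val x p p = x by rewrite /sm_val leqnn.
have sm0 (x : R) p : (0 < p)%N -> sm_val x p 0 = 0.
  by case: p.
have o1 : 2 <= r * E (two_active i j (sm_val 1 1) (sm_val 1 1)) := opt 1 1 1%N 1%N 1%N 1%N 2 ler01 ler01 m1 m1 Hm erefl.
have o2 : K <= r * E (two_active i j (sm_val K m) (sm_val 1 1)).
  apply: (opt K 1 m 1%N m 0%N K KK ler01 mm m1); first by rewrite addn0.
  by rewrite smT sm0 // addr0.
have o3 : K <= r * E (two_active i j (sm_val 1 1) (sm_val K m)).
  apply: (opt 1 K 1%N m 0%N m K ler01 KK m1 mm); first by rewrite add0n.
  by rewrite smT sm0 // add0r.
have o4 : K ^+ 3 <= r * E (two_active i j (sm_val (K ^+ 2) 1) (sm_val (K ^+ 3) m)).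
  apply: (opt (K ^+ 2) (K ^+ 3) 1%N m 0%N m _ K20 K30 m1 mm); first by rewrite add0n.
  by rewrite smT sm0 // add0r.
have o5 : K ^+ 3 <= r * E (two_active i j (sm_val (K ^+ 3) m) (sm_val (K ^+ 2) 1)).
  apply: (opt (K ^+ 3) (K ^+ 2) m 1%N m 0%N _ K30 K20 mm m1); first by rewrite addn0.
  by rewrite smT sm0 // addr0.
have i1 := integ 1 1 1%N 1%N ler01 ler01 m1 m1.
have i2 := integ K 1 m 1%N KK ler01 mm m1.
have i3 := integ 1 K 1%N m ler01 KK m1 mm.
have i4 := integ _ _ 1%N m K20 K30 m1 mm.
have i5 := integ _ _ m 1%N K30 K20 mm m1.
move: i1 i2 i3 i4 i5 o1 o2 o3 o4 o5.
have := fun w => hard_welfare_sum K _ (strat w) i j K1 Hm (Hgood w) ij.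
rewrite /E /W; 
set f1 := two_active i j _ _; set f2 := two_active i j _ _;
set f3 := two_active i j _ _; set f4 := two_active i j _ _;
set f5 := two_active i j _ _.
move=> sum_le i1 i2 i3 i4 i5 o1 o2 o3 o4 o5.
have [j2 e2] := Rintegral_addZ Pr K^-1 _ _ i1 i2.
have [j3 e3] := Rintegral_addZ Pr K^-1 _ _ j2 i3.
have [j4 e4] := Rintegral_addZ Pr (K^-1 ^+ 3) _ _ j3 i4.
have [j5 e5] := Rintegral_addZ Pr (K^-1 ^+ 3) _ _ j4 i5.
have := le_Rintegral mT j5 
  (finite_measure_integrable_cst Pr (5 + K^-1) mT) (fun w _ => sum_le w).
rewrite [X in _ <= X]Rintegral_cst // [X in fine X]probability_setT mulr1 e5 e4 e3 e2.
have : 0 <= E f1.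
  by apply: Rintegral_ge0 => w _; have /andP[] := bound 1 1 1%N 1%N ler01 ler01 w.
rewrite /E /W; move: o1 o2 o3 o4 o5.
move: (\int[Pr]_w welfare (mech w) (strat w) f1)%R => e_1.
move: (\int[Pr]_w welfare (mech w) (strat w) f2)%R => e_2.
move: (\int[Pr]_w welfare (mech w) (strat w) f3)%R => e_3.
move: (\int[Pr]_w welfare (mech w) (strat w) f4)%R => e_4.
move: (\int[Pr]_w welfare (mech w) (strat w) f5)%R => e_5.
move=> o1 o2 o3 o4 o5 e_1_ge0 total.
(* From [2 <= r * e_1] and [0 <= e_1]. *)
have r_gt0 : 0 < r by rewrite ltNge; apply/negP => r_le0; nra.
have scaled c e : 0 < c -> c <= r * e -> 1 <= r * (c^-1 * e).
  by move=> c0 ce; rewrite mulrCA -(ler_pM2l c0) mulVKf ?mulr1 ?gt_eqF.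
have {}o2 := scaled _ _ K0 o2; have {}o3 := scaled _ _ K0 o3.
have K3 : 0 < K ^+ 3 by rewrite exprn_gt0.
have {}o4 := scaled _ _ K3 o4; have {}o5 := scaled _ _ K3 o5.
rewrite -exprVn in o4 o5.
(* The five lower bounds 2, 1, 1, 1, 1 give [6 <= r * (5 + K^-1)], against [rK]. *)
have := ler_wpM2l (ltW r_gt0) total; rewrite !mulrDr in rK *; lra.
Qed.
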